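(* For $n\ge 1$, let $g_{n,5}$ denote the number of standard Young tableaux of truncated shifted shape with $n$ rows and $5$ boxes in each row. Then $g_{1,5}=1$, $g_{2,5}=14$, $g_{3,5}=290$, and for all $n\ge 4$, $$g_{n,5}=24g_{n-1,5}-40g_{n-2,5}-8g_{n-3,5}.$$
   Context: The truncated shifted shape with $n$ rows and $k$ boxes in each row is the set of boxes $(i,c)$ with $1\le i\le n$ and $i\le c\le i+k-1$ (row $i$ consists of $k$ consecutive boxes starting in column $i$). A standard Young tableau of this shape is a bijective labeling of its $nk$ boxes by $\{1,\dots,nk\}$ such that labels increase from left to right along each row and from top to bottom along each column. *)

(* Defs.v *)
From mathcomp Require Import all_boot all_order all_algebra.

Set Implicit Arguments.
Unset Strict Implicit.
Unset Printing Implicit Defensive.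

(* Rows, columns and labels are all shifted down by one, as
   usual for ordinals: the box (i, c) with 1 <= i <= n and i <= c <= i + k - 1
   is the pair (i - 1, c - i) : 'I_n * 'I_k, and the label m of {1, ..., n * k}
   is m - 1 : 'I_(n * k). *)
Definition box (n k : nat) : finType := ('I_n * 'I_k)%type.

Definition row_of (n k : nat) (b : box n k) : nat := b.1.

(* The second component of b is only the position of b inside its row. *)
Definition col_of (n k : nat) (b : box n k) : nat := b.1 + b.2.

Definition labeling (n k : nat) : finType := {ffun box n k -> 'I_(n * k)}.

Definition bijective_labeling (n k : nat) (T : labeling n k) : bool :=
  injectiveb T && [forall m, m \in codom T].

Definition rows_increasing (n k : nat) (T : labeling n k) : bool :=
  [forall b : box n k, forall b' : box n k,
     (row_of b == row_of b') && (col_of b < col_of b') ==> (T b < T b')].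

Definition cols_increasing (n k : nat) (T : labeling n k) : bool :=
  [forall b : box n k, forall b' : box n k,
     (col_of b == col_of b') && (row_of b < row_of b') ==> (T b < T b')].

Definition standard_tableau (n k : nat) (T : labeling n k) : bool :=
  [&& bijective_labeling T, rows_increasing T & cols_increasing T].

Definition g (n k : nat) : nat := #|[set T : labeling n k | standard_tableau T]|.

(* Main.v *)
(* An order ideal of the shape consists of m full rows followed by partial rows
   whose lengths lie in {1, ..., 4} and strictly decrease, so up to m it is one
   of the 16 subsets of {1, ..., 4}. Adding the boxes in the order of their
   labels turns a tableau into a walk of length 5n on these subsets that starts
   and ends at the empty one. The number of boxes fixes the sum of the subset
   modulo 5, so after a multiple of 5 steps only {}, {4,1}, {3,2} and {4,3,2,1}
   can occur; the characteristic polynomial x (x^3 - 24 x^2 + 40 x + 8) of the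
   resulting 4 x 4 matrix gives the recurrence, whose extra factor x is why it
   starts at n = 4. *)
Require Import Defs.
From mathcomp Require Import all_boot all_order all_algebra.
From mathcomp Require Import zify.

Set Implicit Arguments.
Unset Strict Implicit.
Unset Printing Implicit Defensive.

(** * Linear extensions counted by growing order ideals *)

Section LinearExtensions.

Variables (X : finType) (lt : rel X).

Definition linear_extension (N : nat) (T : {ffun X -> 'I_N}) : bool :=
  [&& injectiveb T, [forall m, m \in codom T]
    & [forall x, forall y, lt x y ==> (T x < T y)]].

Definition addable (A : {set X}) (x : X) : bool :=
  (x \notin A) && [forall y, lt y x ==> (y \in A)].

Fixpoint growths (r : nat) (A : {set X}) : nat :=
  if r is r'.+1 then \sum_(x | addable A x) growths r' (x |: A) else 1.

(* p lists the elements of X with labels 0, ..., size p - 1. *)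
Definition starts_with (N : nat) (p : seq X) (T : {ffun X -> 'I_N}) : bool :=
  [seq val (T x) | x <- p] == iota 0 (size p).

Lemma starts_with_rcons N p x (T : {ffun X -> 'I_N}) :
  starts_with (rcons p x) T = starts_with p T && (T x == size p :> nat).
Proof.
rewrite /starts_with map_rcons size_rcons -addn1 iotaD cats1 add0n.
by rewrite eqseq_rcons.
Qed.

Lemma starts_with_mem N p (T : {ffun X -> 'I_N}) y :
  injective T -> starts_with p T -> T y < size p -> y \in p.
Proof.
move=> injT /eqP Tp lt_y.
have: val (T y) \in [seq val (T x) | x <- p] by rewrite Tp mem_iota.
by case/mapP=> x xp /val_inj /injT ->.
Qed.

Lemma starts_with_index N p (T : {ffun X -> 'I_N}) x :
  starts_with p T -> x \in p -> T x = index x p :> nat.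
Proof.
move=> /eqP Tp xp; have lt_xp : index x p < size p by rewrite index_mem.
have := congr1 (nth 0 ^~ (index x p)) Tp.
by rewrite (nth_map x) // nth_index // nth_iota.
Qed.

(** Surjectivity of [T] provides, and injectivity makes unique, the element carrying the next label
    [size p]; the sum sorts the extensions by it. *)
Lemma card_linear_extension_split N (p : seq X) (lt_pN : size p < N) :
  #|[set T : {ffun X -> 'I_N} | linear_extension T & starts_with p T]| =
  \sum_x #|[set T : {ffun X -> 'I_N} |
              linear_extension T & starts_with (rcons p x) T]|.
Proof.
under eq_bigr => x _.
  rewrite -sum1dep_card.
  rewrite (eq_bigl (fun T : {ffun X -> 'I_N} =>
    (linear_extension T && starts_with p T)
    && (T x == size p :> nat))); last first.
    by move=> T; rewrite starts_with_rcons andbA.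
  over.
rewrite (exchange_big_dep (fun T : {ffun X -> 'I_N} =>
   linear_extension T && starts_with p T)) /=; last by move=> x T _ /andP[].
rewrite -sum1dep_card; apply: eq_bigr => T linT.
have /and3P[/injectiveP injT /forallP surT _] := proj1 (andP linT).
have /codomP[z Tz] := surT (Ordinal lt_pN).
by rewrite (big_pred1 z) // => x; rewrite linT /= -(inj_eq injT) -Tz -val_eqE.
Qed.

Lemma linear_extension_exists N (p : seq X) :
  #|X| = N -> size p = N -> uniq p ->
  exists T : {ffun X -> 'I_N}, forall x, T x = index x p :> nat.
Proof.
move=> cardX sz_p Up.
have all_p x : index x p < N.
  have cardp : #|p| = #|X| by rewrite (card_uniqP Up) sz_p cardX.
  by rewrite -sz_p index_mem (subset_cardP cardp (subset_predT _)).
by exists [ffun x => Ordinal (all_p x)] => x; rewrite ffunE.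
Qed.

(** Induction on the number [r] of labels still to be placed. The order inside [p] already respects
    [lt], so only its underlying set matters. At [r = 0] the one labeling left is [index] in [p]. *)
Lemma card_linear_extension_prefix N (p : seq X) (r : nat) :
  #|X| = N -> size p + r = N -> uniq p ->
  (forall x y, y \in p -> lt x y -> index x p < index y p) ->
  #|[set T : {ffun X -> 'I_N} | linear_extension T & starts_with p T]| =
  growths r [set x in p].
Proof.
move=> cardX; elim: r p => [|r IHr] p sz_p Up p_closed /=.
  rewrite addn0 in sz_p.
  have [T0 T0E] := linear_extension_exists cardX sz_p Up.
  have all_p x : x \in p by rewrite -index_mem -T0E sz_p ltn_ord.
  rewrite -(cards1 T0); congr #|pred_of_set _|; apply/setP=> T.
  rewrite !inE; apply/andP/eqP=> [[_ Tp]|->].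
    by apply/ffunP=> x; apply: val_inj; rewrite /= T0E (starts_with_index Tp).
  have injT0 : injective T0.
    move=> x y /(congr1 val); rewrite /= !T0E => eq_xy.
    by rewrite -(nth_index x (all_p x)) eq_xy nth_index.
  split.
    apply/and3P; split; first exact/injectiveP.
      by apply/forallP=> m; apply: inj_card_onto; rewrite // card_ord cardX.
    apply/forallP=> x; apply/forallP=> y; apply/implyP=> /p_closed.
    by rewrite !T0E; apply.
  apply/eqP/(@eq_from_nth _ 0); rewrite ?size_map ?size_iota // => i lt_ip.
  have x0 : X by case: (p) lt_ip.
  by rewrite (nth_map x0) // nth_iota //= T0E index_uniq.
rewrite card_linear_extension_split -?sz_p ?ltnS ?leq_addr //; last first.
  by rewrite addnS ltnS leq_addr.
rewrite sz_p big_mkcond [RHS]big_mkcond; apply: eq_bigr => x _.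
case: ifP => [/andP[xp /forallP lt_x]|].
  rewrite inE in xp.
  rewrite IHr ?size_rcons ?addSnnS ?rcons_uniq ?xp //.
    by congr growths; apply/setP=> y; rewrite !inE mem_rcons.
  move=> y z; rewrite mem_rcons inE -cats1 !index_cat.
  have [->|_] /= := eqVneq z x.
    move=> _ /(implyP (lt_x y)); rewrite inE => yp.
    by rewrite yp (negbTE xp) /= eqxx addn0 index_mem.
  move=> zp lt_yz; have := p_closed _ _ zp lt_yz; rewrite zp.
  by move=> lt_i; rewrite -index_mem (ltn_trans lt_i) ?index_mem.
(* No extension gives the next label to such an [x]: it is already in [p], or something below it is
   not. *)
move=> /negP not_addable; apply/eqP; rewrite cards_eq0 -subset0.
apply/subsetP=> T; rewrite inE starts_with_rcons => /and3P[linT Tp /eqP Tx].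
have /and3P[/injectiveP injT _ /forallP Tlt] := linT.
case: not_addable; apply/andP; split.
  rewrite inE; apply/negP=> xp; have := index_mem x p.
  by rewrite xp -(starts_with_index Tp xp) Tx ltnn.
apply/forallP=> y; apply/implyP=> /(implyP (forallP (Tlt y) x)).
by rewrite inE Tx; apply: starts_with_mem.
Qed.

Lemma card_linear_extension N :
  #|X| = N ->
  #|[set T : {ffun X -> 'I_N} | linear_extension T]| = growths N set0.
Proof.
move=> cardX; have -> : set0 = [set x in [::] : seq X].
  by apply/setP=> x; rewrite !inE.
rewrite -(@card_linear_extension_prefix N) //; congr #|pred_of_set _|.
by apply/setP=> T; rewrite !inE andbT.
Qed.

End LinearExtensions.

(** * Tableaux as linear extensions of the boxes *)

Definition box_lt (n k : nat) : rel (box n k) := fun b b' =>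
  (row_of b == row_of b') && (col_of b < col_of b')
  || (col_of b == col_of b') && (row_of b < row_of b').

Lemma g_growths n k : g n k = growths (@box_lt n k) (n * k) set0.
Proof.
rewrite -card_linear_extension ?card_prod ?card_ord //.
congr #|pred_of_set _|; apply/setP=> T; rewrite !inE.
rewrite /standard_tableau /linear_extension /bijective_labeling -!andbA.
do 2!congr andb.
apply/andP/forallP=> [[/forallP Trow /forallP Tcol] b | Tlt].
  apply/forallP=> b'; apply/implyP=> /orP[]; apply/implyP.
    exact: (forallP (Trow b)).
  exact: (forallP (Tcol b)).
split; apply/forallP=> b; apply/forallP=> b'; apply/implyP=> lt_b;
  by apply: (implyP (forallP (Tlt b) b')); rewrite /box_lt lt_b ?orbT.
Qed.

(** * Profiles of order ideals and walks on them *)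

Definition profiles : seq (seq nat) :=
  foldr (fun a ss => [seq a :: s | s <- ss] ++ ss) [:: [::]] [:: 4; 3; 2; 1].

(* t = size s stands for starting a new row. *)
Definition growable (s : seq nat) (t : nat) : bool :=
  (t == 0) || ((nth 0 s t).+1 < nth 0 s t.-1).

(* Only the first row can become full, as the others are shorter than it. *)
Definition grow (s : seq nat) (t : nat) : seq nat :=
  let s' := incr_nth s t in if head 0 s' == 5 then behead s' else s'.

(** Unlike [growths], this does not see the number [n] of rows, so one finite transfer matrix serves
    all [n]. *)
Fixpoint walks (r : nat) (s : seq nat) : nat :=
  if r is r'.+1 then
    sumn [seq if growable s t then walks r' (grow s t) else 0
         | t <- iota 0 (size s).+1]
  else s == [::].

(** The default 0 of [nth] leaves the rows beyond those listed in [s] empty. *)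
Definition shape (n m : nat) (s : seq nat) : {set box n 5} :=
  [set b : box n 5 | b.2 < if b.1 < m then 5 else nth 0 s (b.1 - m)].

Lemma profiles_nth_lt (s : seq nat) t :
  s \in profiles -> nth 0 s t < 5 - (0 < t).
Proof.
(* Exhaustive evaluation over the 16 profiles. *)
move=> sP; have : all (fun s =>
    all (fun t => nth 0 s t < 5 - (0 < t)) (iota 0 (size s))) profiles by [].
move=> /allP/(_ s sP)/allP/(_ t); rewrite mem_iota /= add0n.
by case: ltnP => [_ ->//|le_t _]; rewrite nth_default //; case: t {le_t}.
Qed.

(** [growable] compares neighbouring rows only; strict decrease carries this to all rows above. As
    each row is shifted by one column, the column of the new box of row [t] meets row [u] at
    position [nth 0 s t + (t - u)]. *)
Lemma profiles_growable (s : seq nat) t u :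
  s \in profiles -> t <= size s -> growable s t -> u < t ->
  nth 0 s t + (t - u) < nth 0 s u.
Proof.
move=> sP; have : all (fun s => all (fun t => growable s t ==>
    all (fun u => nth 0 s t + (t - u) < nth 0 s u) (iota 0 t))
    (iota 0 (size s).+1)) profiles by [].
move=> /allP/(_ s sP)/allP/(_ t); rewrite mem_iota /= add0n ltnS.
move=> + le_t => /(_ le_t)/implyP + st_t => /(_ st_t)/allP/(_ u).
by rewrite mem_iota.
Qed.

(** * Addable boxes of a shape *)

Lemma addable_shape n m (s : seq nat) (b : box n 5) : s \in profiles ->
  addable (@box_lt n 5) (shape n m s) b =
  [&& m <= b.1, b.1 - m <= size s, growable s (b.1 - m)
    & b.2 == nth 0 s (b.1 - m) :> nat].
Proof.
case: b => i j sP; rewrite /addable inE /=.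
have [lt_im|le_mi] /= := ltnP i m; first by rewrite ltn_ord.
rewrite -leqNgt; set t := i - m.
have lt_t := profiles_nth_lt t sP.
apply/andP/and3P=> [[le_tj /forallP lt_inA]|[le_ts st_t /eqP jE]].
  have jE : j = nth 0 s t :> nat.
    apply/eqP; rewrite eqn_leq le_tj andbT leqNgt; apply/negP=> lt_tj.
    have lt_t5 : nth 0 s t < 5 := ltn_trans lt_tj (ltn_ord j).
    (* Otherwise the first empty box of row [i] lies to the left and would have to be present. *)
    have := implyP (lt_inA (i, Ordinal lt_t5)).
    rewrite /box_lt /row_of /col_of /= eqxx ltn_add2l lt_tj inE /=.
    by rewrite ifN -?leqNgt // -/t ltnn => /(_ isT).
  have [t0|t_gt0] := posnP t.
    by rewrite jE eqxx t0.
  (* Rows after the first partial one have at most 3 boxes, so the box directly above, at position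
     [j.+1] of the previous row, exists. *)
  have lt_j5 : j.+1 < 5 by lia.
  have lt_in : i.-1 < n by apply: leq_ltn_trans (ltn_ord i); lia.
  have := implyP (lt_inA (Ordinal lt_in, Ordinal lt_j5)).
  rewrite /box_lt /row_of /col_of inE /=.
  have -> : (i.-1 + j.+1 == i + j) && (i.-1 < i) by lia.
  rewrite orbT ifN; last by lia.
  have -> : i.-1 - m = t.-1 by lia.
  move=> /(_ isT) lt_jt.
  rewrite /growable -jE lt_jt orbT eqxx; split=> //.
  rewrite leqNgt; apply/negP=> lt_st; move: lt_jt; rewrite nth_default //; lia.
rewrite jE leqnn; split=> //; apply/forallP=> -[i' j']; apply/implyP.
rewrite /box_lt /row_of /col_of inE /=.
case/orP=> /andP[/eqP].
  by move=> -> lt_j; rewrite ifN -?leqNgt // -/t; lia.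
move=> eq_c lt_i; have [_|le_mi'] := ltnP i' m; first exact: ltn_ord.
have := @profiles_growable s t (i' - m) sP le_ts st_t. lia.
Qed.

Lemma setU1_shape n m s (b : box n 5) :
  m <= b.1 -> b.2 = nth 0 s (b.1 - m) :> nat ->
  b |: shape n m s = shape n m (incr_nth s (b.1 - m)).
Proof.
case: b => i j /= le_mi jE; apply/setP=> -[i' j'].
rewrite !inE xpair_eqE -!val_eqE /=.
have [lt_im|le_mi'] := ltnP i' m.
  by rewrite ltn_ord orbT.
rewrite nth_incr_nth eqn_sub2rE //.
have [->|ne_i] := eqVneq (i' : nat) i; rewrite ?eqxx /=.
  by rewrite -jE add1n ltnS [RHS]leq_eqVlt.
by [].
Qed.

Lemma shape_behead n m s :
  head 0 s = 5 -> shape n m s = shape n m.+1 (behead s).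
Proof.
case: s => //= a s ->; apply/setP=> b; rewrite !inE ltnS.
have [lt_bm|lt_mb|->] := ltngtP b.1 m; rewrite ?ltn_ord //.
  by rewrite -[b.1 - m]prednK ?subn_gt0 // -subnS.
by rewrite subnn /= ltn_ord.
Qed.

(** Each row offers at most one addable box, so the sum over boxes becomes a sum over rows. *)
Lemma growths_shape_rec n m (s : seq nat) r :
  s \in profiles -> m + size s <= n ->
  growths (@box_lt n 5) r.+1 (shape n m s) =
  \sum_(0 <= t < (size s).+1 | growable s t && (m + t < n))
     growths (@box_lt n 5) r (shape n m (incr_nth s t)).
Proof.
move=> sP le_n /=.
pose G t := growths (@box_lt n 5) r (shape n m (incr_nth s t)).
pose Q t := (t <= size s) && growable s t.
transitivity (\sum_(i < n | (m <= i) && Q (i - m)) G (i - m)).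
  transitivity (\sum_(b : 'I_n * 'I_5 | ((m <= b.1) && Q (b.1 - m))
      && (b.2 == nth 0 s (b.1 - m) :> nat)) G (b.1 - m)).
    apply: eq_big => b; first by rewrite addable_shape // /Q !andbA.
    rewrite addable_shape // => /and4P[le_mb _ _ /eqP bE].
    by rewrite setU1_shape.
  rewrite -(pair_big_dep (fun i : 'I_n => (m <= i) && Q (i - m))
    (fun (i : 'I_n) (j : 'I_5) => j == nth 0 s (i - m) :> nat)
    (fun i _ => G (i - m))) /=.
  apply: eq_bigr => i _.
  have lt_5 : nth 0 s (i - m) < 5.
    by apply: leq_trans (profiles_nth_lt _ sP) _; rewrite leq_subr.
  by rewrite (big_pred1 (Ordinal lt_5)).
rewrite -(big_mkord (fun i => (m <= i) && Q (i - m)) (fun i => G (i - m))).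
have le_mn : m <= n := leq_trans (leq_addr _ _) le_n.
rewrite (@big_cat_nat _ _ _ m) //= big_nat_cond big_pred0 => [|i]; last by lia.
rewrite add0n -{1}[m]add0n big_addn.
rewrite (eq_bigl Q) => [|t]; last by rewrite leq_addl addnK.
under eq_bigr do rewrite addnK.
rewrite !(big_mkcond _ G) /= /Q.
(* Either a new row [t = size s] can still be opened, or [s] reaches the last row and the side
   condition removes that term. *)
have [lt_n|ge_n] := ltnP (m + size s) n.
  have lt_nm : (size s).+1 <= n - m by lia.
  rewrite (@big_cat_nat _ _ _ (size s).+1) //= [X in _ + X]big_nat_cond.
  rewrite [X in _ + X]big1 ?addn0 => [|t]; last by case: ifP; lia.
  apply: eq_big_nat => t lt_t; have -> : m + t < n by lia.
  by rewrite andbT -ltnS (andP lt_t).2.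
have -> : n - m = size s by lia.
rewrite big_nat_recr //= [X in _ = _ + X]ifN ?addn0; last by lia.
apply: eq_big_nat => t lt_t; have -> : m + t < n by lia.
by rewrite andbT ltnW ?(andP lt_t).2.
Qed.

(** * From growths of shapes to walks *)

Lemma walksS r s : walks r.+1 s =
  \sum_(0 <= t < (size s).+1 | growable s t) walks r (grow s t).
Proof. by rewrite [RHS]big_mkcond -(big_map _ xpredT id) -sumnE. Qed.

Lemma sumn_incr_nth s t : sumn (incr_nth s t) = (sumn s).+1.
Proof.
elim: s t => [|a s IHs] [|t] //=; last by rewrite IHs addnS.
by rewrite /incr_nth /=; elim: t.
Qed.

(** The boolean, read as 0 or 1, counts the row completed by the step, which then leaves the
    profile. *)
Lemma size_grow s t :
  size (grow s t) + (head 0 (incr_nth s t) == 5) = maxn (size s) t.+1.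
Proof.
have -> : maxn (size s) t.+1 = size (incr_nth s t).
  by rewrite size_incr_nth; case: ltnP; lia.
by rewrite /grow; case: (incr_nth s t) => //= a l; case: eqP => /=; lia.
Qed.

Lemma sumn_grow s t :
  sumn (grow s t) + 5 * (head 0 (incr_nth s t) == 5) = (sumn s).+1.
Proof.
rewrite -(sumn_incr_nth s t) /grow.
by case: (incr_nth s t) => //= a l; case: eqP => [->|_] /=; lia.
Qed.

Lemma shape_grow n m s t :
  shape n m (incr_nth s t) =
  shape n (m + (head 0 (incr_nth s t) == 5)) (grow s t).
Proof.
by rewrite /grow; case: eqP => [h5|_]; rewrite ?addn0 // addn1 -shape_behead.
Qed.

Lemma grow_profiles (s : seq nat) t :
  s \in profiles -> t <= size s -> growable s t -> grow s t \in profiles.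
Proof.
move=> sP; have : all (fun s =>
    all (fun t => growable s t ==> (grow s t \in profiles))
    (iota 0 (size s).+1)) profiles by [].
move=> /allP/(_ s sP)/allP/(_ t); rewrite mem_iota /= add0n ltnS.
by move=> + le_t => /(_ le_t)/implyP.
Qed.

(* The rows listed in s still miss 5 * size s - sumn s boxes. This is how the
   walks that would open more than n rows drop out. *)
Lemma walks_eq0 r (s : seq nat) :
  s \in profiles -> sumn s + r < 5 * size s -> walks r s = 0.
Proof.
elim: r s => [|r IHr] s sP lt_s; first by case: s {sP} lt_s.
rewrite walksS big_nat_cond big1 // => t /andP[/andP[_ lt_t] st_t].
apply: IHr; first exact: grow_profiles.
(* A step trades one unit of [r] for one box, and a completed row takes 5 from both sides, so the
   deficit persists. *)
have := size_grow s t; have := sumn_grow s t.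
lia.
Qed.

Lemma profiles_sumn (s : seq nat) :
  s \in profiles -> 5 * size s <= sumn s -> s = [::].
Proof.
move=> sP; have : all (fun s =>
    (5 * size s <= sumn s) ==> (s == [::])) profiles by [].
by move=> /allP/(_ s sP)/implyP + le_s => /(_ le_s)/eqP.
Qed.

(** The last hypothesis says that exactly [r] boxes are missing. The two recursions agree term by
    term, except that a walk may open a row beyond the last. *)
Lemma growths_shape n r m (s : seq nat) :
  s \in profiles -> m + size s <= n -> 5 * m + sumn s + r = 5 * n ->
  growths (@box_lt n 5) r (shape n m s) = walks r s.
Proof.
elim: r m s => [|r IHr] m s sP le_n sum_n.
  by rewrite /= (profiles_sumn sP) //; lia.
rewrite growths_shape_rec // walksS big_mkcondr /=.
rewrite big_nat_cond [RHS]big_nat_cond.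
apply: eq_bigr => t /andP[/andP[_ le_t] st_t]; rewrite ltnS in le_t.
have tP := grow_profiles sP le_t st_t.
rewrite shape_grow; have := size_grow s t; have := sumn_grow s t.
move: (head 0 _ == 5) => d sum_g size_g.
case: ltnP => [lt_n|ge_n]; first by apply: IHr => //; lia.
(* Here [t = size s] and [m + size s = n]: the extra row leaves more boxes missing than steps. *)
by rewrite walks_eq0 //; lia.
Qed.

Lemma g_walks n : g n 5 = walks (n * 5) [::].
Proof.
rewrite g_growths; have -> : set0 = shape n 0 [::].
  by apply/setP=> b; rewrite !inE nth_nil.
by apply: growths_shape => //=; lia.
Qed.

(** * The five-step transfer matrix and the recurrence *)

Lemma walks5 r :
  [/\ walks (5 + r) [::] =
        walks r [::] + 3 * walks r [:: 4; 1] + 2 * walks r [:: 3; 2],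
      walks (5 + r) [:: 4; 1] =
        3 * walks r [::] + 11 * walks r [:: 4; 1] + 10 * walks r [:: 3; 2]
        + 2 * walks r [:: 4; 3; 2; 1],
      walks (5 + r) [:: 3; 2] =
        2 * walks r [::] + 10 * walks r [:: 4; 1] + 11 * walks r [:: 3; 2]
        + 3 * walks r [:: 4; 3; 2; 1]
    & walks (5 + r) [:: 4; 3; 2; 1] =
        2 * walks r [:: 4; 1] + 3 * walks r [:: 3; 2]
        + walks r [:: 4; 3; 2; 1]].
(* As [r] stays symbolic, evaluation unfolds exactly five steps; [lia] collects the walks by end
   point. *)
Proof. by rewrite !addSn add0n; split=> /=; rewrite /grow /=; lia. Qed.

Import GRing.Theory.
Local Open Scope ring_scope.

Theorem theorem3 :
  [/\ g 1 5 = 1%N,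
      g 2 5 = 14%N,
      g 3 5 = 290%N
    & forall n : nat, (4 <= n)%N ->
        (g n 5)%:Z = 24 * (g (n - 1) 5)%:Z - 40 * (g (n - 2) 5)%:Z
                     - 8 * (g (n - 3) 5)%:Z].
Proof.
split; first by rewrite g_walks; vm_compute.
- by rewrite g_walks; vm_compute.
- by rewrite g_walks; vm_compute.
case=> [|[|[|[|n]]]] // _; rewrite !subSS !subn0 !g_walks.
rewrite !mulSn.
(* These relations make every count in the goal a linear combination of the four counts at [n * 5];
   the identity left is an entry-wise instance of Cayley-Hamilton. *)
have [a0 b0 c0 d0] := walks5 (n * 5).
have [a1 b1 c1 d1] := walks5 (5 + n * 5).
have [a2 b2 c2 d2] := walks5 (5 + (5 + n * 5)).
have [a3 _ _ _] := walks5 (5 + (5 + (5 + n * 5))).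
lia.
Qed.
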